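(* Consider the LSTM network \[ \begin{aligned} x^+ &= \sigma_g(W_f u + U_f \xi + b_f)\circ x + \sigma_g(W_i u + U_i \xi + b_i)\circ \sigma_c(W_c u + U_c \xi + b_c),\\ \xi^+ &= \sigma_g(W_o u + U_o \xi + b_o)\circ \sigma_c(x^+),\qquad y = C\xi + b_y, \end{aligned} \] with state $\chi=(x,\xi)$ and inputs in $\mathcal{U}=[-u_{\max},u_{\max}]^{n_u}$. Let \[ \alpha=\tfrac14\|U_f\|\frac{\bar{\sigma}_g^i\bar{\sigma}_c^c}{1-\bar{\sigma}_g^f}+\bar{\sigma}_g^i\|U_c\|+\tfrac14\|U_i\|\bar{\sigma}_c^c,\qquad A_\delta=\begin{bmatrix}\bar{\sigma}_g^f & \alpha\\ \bar{\sigma}_g^o\bar{\sigma}_g^f & \alpha\bar{\sigma}_g^o+\tfrac14\bar{\sigma}_c^x\|U_o\|\end{bmatrix}. \] If $\rho(A_\delta)<1$, then the network is incrementally input-to-state stable ($\delta$ISS): there exist $\beta_\delta\in\mathcal{KL}$ and $\gamma_\delta\in\mathcal{K}_\infty$ such that for every $k\in\mathbb{Z}_{\ge0}$, all initial states $\chi_{01},\chi_{02}\in\mathcal{X}$ and all input sequences $u_1(\cdot),u_2(\cdot)$ with values in $\mathcal{U}$, the corresponding solutions satisfy \[ \|\chi_1(k)-\chi_2(k)\|\le\beta_\delta(\|\chi_{01}-\chi_{02}\|,k)+\gamma_\delta\big(\max_{h\ge0}\|u_1(h)-u_2(h)\|\big). \]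
   Context: $\sigma_g(t)=1/(1+e^{-t})$, $\sigma_c=\tanh$, applied entrywise; $\circ$ is the Hadamard product. $\|\cdot\|$ is the Euclidean/induced 2-norm, $\|\cdot\|_\infty$ the induced $\infty$-norm, $\rho$ the spectral radius. For $\star\in\{f,i,o\}$, $\bar{\sigma}_g^\star=\sigma_g(\|[W_\star u_{\max}\ U_\star\ b_\star]\|_\infty)$ (horizontal concatenation); $\bar{\sigma}_c^c=\sigma_c(\|[W_c u_{\max}\ U_c\ b_c]\|_\infty)$; $\bar{\sigma}_c^x=\sigma_c\big(\bar{\sigma}_g^i\bar{\sigma}_c^c/(1-\bar{\sigma}_g^f)\big)$. The state set is $\mathcal{X}=\{(x,\xi):|x_{(j)}|\le\bar{\sigma}_g^i\bar{\sigma}_c^c/(1-\bar{\sigma}_g^f),\ \xi_{(j)}\in(-1,1),\ j=1,\dots,n_x\}$. $\mathcal{K},\mathcal{K}_\infty,\mathcal{KL}$ are the standard comparison-function classes. *)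

(* Defs.v *)
From HB Require Import structures.
From mathcomp Require Import all_boot all_order all_algebra.
From mathcomp Require Import all_classical all_reals all_analysis.
From mathcomp Require complex.
Import complex.ComplexField.
Set Implicit Arguments. Unset Strict Implicit. Unset Printing Implicit Defensive.
Import Order.TTheory GRing.Theory Num.Theory.
Import numFieldNormedType.Exports.
Local Open Scope classical_set_scope.
Local Open Scope ring_scope.

Section LSTMDefs.
Variable R : realType.

Definition sigmoid (t : R) : R := 1 / (1 + expR (- t)).
Definition tanhR (t : R) : R := (expR t - expR (- t)) / (expR t + expR (- t)).

Definition cmap {n} (f : R -> R) (v : 'cV[R]_n) : 'cV[R]_n := map_mx f v.
Definition hadamard {n} (v w : 'cV[R]_n) : 'cV[R]_n :=
  \col_i (v i 0 * w i 0).

Definition norm2 {n} (v : 'cV[R]_n) : R := Num.sqrt (\sum_i (v i 0) ^+ 2).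
Definition norminf {n} (v : 'cV[R]_n) : R := \big[Num.max/0]_i `|v i 0|.

Definition opnorm2 {m n} (A : 'M[R]_(m, n)) : R :=
  sup [set norm2 (A *m v) | v in [set v : 'cV[R]_n | norm2 v <= 1]].
Definition opnorminf {m n} (A : 'M[R]_(m, n)) : R :=
  sup [set norminf (A *m v) | v in [set v : 'cV[R]_n | norminf v <= 1]].

Definition specrad {n} (A : 'M[R]_n) : R :=
  sup [set complex.ComplexField.Normc.normc l | l in
        [set l : complex.complex (R : rcfType) |
           @eigenvalue (complex.complex (R : rcfType)) n
             (map_mx (fun a : R => complex.Complex a 0) A) l]].

Definition classK (a : R -> R) : Prop :=
  [/\ {within [set s : R | 0 <= s], continuous a}, a 0 = 0 &
      forall s t, 0 <= s -> s < t -> a s < a t].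
Definition classKinf (a : R -> R) : Prop :=
  classK a /\ a x @[x --> +oo] --> +oo.
Definition classKL (b : R -> nat -> R) : Prop :=
  (forall k, classK (fun s => b s k)) /\
  (forall s, 0 <= s ->
     (forall k l, (k <= l)%N -> b s l <= b s k) /\ b s k @[k --> \oo] --> 0).

Definition mat2 (a b c d : R) : 'M[R]_2 :=
  \matrix_(i < 2, j < 2)
     if i == ord0 then (if j == ord0 then a else b)
     else (if j == ord0 then c else d).

Variables (nx nu : nat).

Record lstm := LSTM {
  Wf : 'M[R]_(nx, nu); Uf : 'M[R]_nx; bf : 'cV[R]_nx;
  Wi : 'M[R]_(nx, nu); Ui : 'M[R]_nx; bi : 'cV[R]_nx;
  Wo : 'M[R]_(nx, nu); Uo : 'M[R]_nx; bo : 'cV[R]_nx;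
  Wc : 'M[R]_(nx, nu); Uc : 'M[R]_nx; bc : 'cV[R]_nx }.

Variable N : lstm.

Definition lstm_step (u : 'cV[R]_nu) (chi : 'cV[R]_nx * 'cV[R]_nx)
  : 'cV[R]_nx * 'cV[R]_nx :=
  let: (x, xi) := chi in
  let xp := hadamard (cmap sigmoid (Wf N *m u + Uf N *m xi + bf N)) x
          + hadamard (cmap sigmoid (Wi N *m u + Ui N *m xi + bi N))
                     (cmap tanhR (Wc N *m u + Uc N *m xi + bc N)) in
  (xp, hadamard (cmap sigmoid (Wo N *m u + Uo N *m xi + bo N)) (cmap tanhR xp)).

Fixpoint lstm_traj (u : nat -> 'cV[R]_nu) (chi0 : 'cV[R]_nx * 'cV[R]_nx)
  (k : nat) : 'cV[R]_nx * 'cV[R]_nx :=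
  match k with
  | 0 => chi0
  | k'.+1 => lstm_step (u k') (lstm_traj u chi0 k')
  end.

Definition state_norm (chi : 'cV[R]_nx * 'cV[R]_nx) : R :=
  norm2 (col_mx chi.1 chi.2).
Definition state_dist (chi1 chi2 : 'cV[R]_nx * 'cV[R]_nx) : R :=
  norm2 (col_mx chi1.1 chi1.2 - col_mx chi2.1 chi2.2).

Variable umax : R.

Definition gate_bound (W : 'M[R]_(nx, nu)) (U : 'M[R]_nx) (b : 'cV[R]_nx) : R :=
  opnorminf (row_mx (row_mx (umax *: W) U) b).
Definition sgf := sigmoid (gate_bound (Wf N) (Uf N) (bf N)).
Definition sgi := sigmoid (gate_bound (Wi N) (Ui N) (bi N)).
Definition sgo := sigmoid (gate_bound (Wo N) (Uo N) (bo N)).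
Definition scc := tanhR (gate_bound (Wc N) (Uc N) (bc N)).
Definition xbound := sgi * scc / (1 - sgf).
Definition scx := tanhR xbound.

Definition alpha_lstm :=
  4^-1 * opnorm2 (Uf N) * xbound + sgi * opnorm2 (Uc N)
  + 4^-1 * opnorm2 (Ui N) * scc.

Definition A_delta : 'M[R]_2 :=
  mat2 sgf alpha_lstm (sgo * sgf) (alpha_lstm * sgo + 4^-1 * scx * opnorm2 (Uo N)).

Definition in_stateset (chi : 'cV[R]_nx * 'cV[R]_nx) : Prop :=
  forall j, `|chi.1 j 0| <= xbound /\ -1 < chi.2 j 0 < 1.
Definition in_inputset (u : 'cV[R]_nu) : Prop := forall j, `|u j 0| <= umax.

Definition input_dist (u1 u2 : nat -> 'cV[R]_nu) : R :=
  sup [set norm2 (u1 h - u2 h) | h in [set: nat]].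

End LSTMDefs.

(* Main.v *)
(** Write [dx], [dxi] and [du] for the Euclidean distances between the cell states,
    the hidden states and the inputs of two trajectories.  The state set is invariant,
    so every gate is bounded by its [sgf], [sgi], [sgo] or [scc]; since [sigmoid] is
    1/4-Lipschitz and [tanhR] is 1-Lipschitz, one step maps [(dx, dxi)] to a pair
    entrywise below [A_delta (dx, dxi)] plus a multiple of [du].  A nonnegative 2x2
    matrix of spectral radius below 1 admits positive weights [p], [q] for which
    [p dx + q dxi] shrinks by a factor [l < 1] at each step up to the input term; the
    resulting geometric bound gives a linear [gamma] and
    [beta s k] proportional to [l ^+ k * s]. *)

Require Import Defs.
From HB Require Import structures.
From mathcomp Require Import all_boot all_order all_algebra.
From mathcomp Require Import all_classical all_reals all_analysis.
From mathcomp Require Import complex.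
From mathcomp Require Import ring lra.
Import ComplexField.
Import Order.TTheory GRing.Theory Num.Theory.
Import numFieldNormedType.Exports.
Local Open Scope classical_set_scope.
Local Open Scope ring_scope.
Set Implicit Arguments.
Unset Strict Implicit.
Unset Printing Implicit Defensive.

(** * Euclidean and maximum norms, and the operator norms they induce *)

Section Norms.
Variable R : realType.

Lemma norm2_ge0 n (v : 'cV[R]_n) : 0 <= norm2 v.
Proof. exact: sqrtr_ge0. Qed.

Lemma sumsq_ge0 n (v : 'cV[R]_n) : 0 <= \sum_i v i 0 ^+ 2.
Proof. by apply: sumr_ge0 => i _; exact: sqr_ge0. Qed.

Lemma sqr_norm2 n (v : 'cV[R]_n) : norm2 v ^+ 2 = \sum_i v i 0 ^+ 2.
Proof. by rewrite sqr_sqrtr // sumsq_ge0. Qed.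

Lemma norm2_0 n : norm2 (0 : 'cV[R]_n) = 0.
Proof.
by rewrite /norm2 big1 ?sqrtr0 // => i _; rewrite mxE expr0n.
Qed.

Lemma norm_coord_le_norm2 n (v : 'cV[R]_n) i : `|v i 0| <= norm2 v.
Proof.
rewrite -sqrtr_sqr ler_sqrt ?sumsq_ge0 // (bigD1 i) //= lerDl.
by apply: sumr_ge0 => j _; exact: sqr_ge0.
Qed.

Lemma norm2_eq0 n (v : 'cV[R]_n) : norm2 v = 0 -> v = 0.
Proof.
move=> v0; apply/matrixP => i j; rewrite ord1 mxE.
by apply/eqP; rewrite -normr_le0 -v0 norm_coord_le_norm2.
Qed.

(** Squares of the entrywise bounds are summed. Every entrywise estimate on gates passes to
    Euclidean norms through this comparison. *)
Lemma norm2_le n (v w : 'cV[R]_n) (c : R) : 0 <= c ->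
  (forall i, `|v i 0| <= c * `|w i 0|) -> norm2 v <= c * norm2 w.
Proof.
move=> c0 vw; rewrite -(ger0_norm c0) -sqrtr_sqr -sqrtrM ?sqr_ge0 //.
rewrite ler_sqrt; last by rewrite mulr_ge0 ?sqr_ge0 ?sumsq_ge0.
rewrite mulr_sumr; apply: ler_sum => i _.
rewrite -[v i 0 ^+ 2]real_normK ?num_real // -[w i 0 ^+ 2]real_normK ?num_real //.
by rewrite -exprMn lerXn2r ?nnegrE ?mulr_ge0.
Qed.

Lemma norm2Z n (a : R) (v : 'cV[R]_n) : norm2 (a *: v) = `|a| * norm2 v.
Proof.
rewrite /norm2 -sqrtr_sqr -sqrtrM ?sqr_ge0 // mulr_sumr.
by congr Num.sqrt; apply: eq_bigr => i _; rewrite mxE exprMn.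
Qed.

Lemma cauchy_schwarz n (v w : 'cV[R]_n) :
  \sum_i v i 0 * w i 0 <= norm2 v * norm2 w.
Proof.
apply: le_trans (ler_norm _) _.
rewrite -ler_sqr ?nnegrE ?mulr_ge0 ?norm2_ge0 // real_normK ?num_real //.
rewrite exprMn !sqr_norm2 -subr_ge0.
(* Lagrange's identity *)
suff -> : (\sum_i v i 0 ^+ 2) * (\sum_i w i 0 ^+ 2) - (\sum_i v i 0 * w i 0) ^+ 2
  = 2^-1 * \sum_i \sum_j (v i 0 * w j 0 - v j 0 * w i 0) ^+ 2.
  rewrite mulr_ge0 ?invr_ge0 //; apply: sumr_ge0 => i _.
  by apply: sumr_ge0 => j _; exact: sqr_ge0.
have -> : \sum_i \sum_j (v i 0 * w j 0 - v j 0 * w i 0) ^+ 2 =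
    \sum_i \sum_j (v i 0 ^+ 2 * w j 0 ^+ 2)
    - 2 * (\sum_i \sum_j (v i 0 * w i 0 * (v j 0 * w j 0)))
    + \sum_i \sum_j (w i 0 ^+ 2 * v j 0 ^+ 2).
  rewrite mulr_sumr -sumrB -big_split; apply: eq_bigr => i _ /=.
  rewrite mulr_sumr -sumrB -big_split; apply: eq_bigr => j _ /=.
  ring.
by rewrite -!big_distrlr /=; field.
Qed.

Lemma norm2D n (v w : 'cV[R]_n) : norm2 (v + w) <= norm2 v + norm2 w.
Proof.
rewrite -ler_sqr ?nnegrE ?addr_ge0 ?norm2_ge0 // sqrrD !sqr_norm2.
have -> : \sum_i (v + w) i 0 ^+ 2 =
    \sum_i v i 0 ^+ 2 + (\sum_i v i 0 * w i 0) *+ 2 + \sum_i w i 0 ^+ 2.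
  rewrite -sumrMnl -!big_split; apply: eq_bigr => i _ /=.
  by rewrite mxE sqrrD.
by rewrite lerD2r lerD2l lerMn2r cauchy_schwarz.
Qed.

(** A crude bound, used to show that the sets under the suprema are bounded. *)
Lemma norm2_le_sum n (v : 'cV[R]_n) : norm2 v <= \sum_i `|v i 0|.
Proof.
rewrite -ler_sqr ?nnegrE ?norm2_ge0 ?sumr_ge0 // sqr_norm2 expr2 mulr_suml.
apply: ler_sum => i _; rewrite -real_normK ?num_real // expr2.
by rewrite ler_wpM2l // (bigD1 i) //= lerDl sumr_ge0.
Qed.

Lemma sqr_norm2_col_mx m n (v : 'cV[R]_m) (w : 'cV[R]_n) :
  norm2 (col_mx v w) ^+ 2 = norm2 v ^+ 2 + norm2 w ^+ 2.
Proof.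
rewrite !sqr_norm2 big_split_ord /=; congr (_ + _); apply: eq_bigr => i _.
- by rewrite col_mxEu.
- by rewrite col_mxEd.
Qed.

Lemma norm2_col_mx_le m n (v : 'cV[R]_m) (w : 'cV[R]_n) :
  norm2 (col_mx v w) <= norm2 v + norm2 w.
Proof.
rewrite -ler_sqr ?nnegrE ?addr_ge0 ?norm2_ge0 // sqr_norm2_col_mx sqrrD.
by rewrite -addrA lerD2l lerDr mulrn_wge0 // mulr_ge0 ?norm2_ge0.
Qed.

Lemma norm2_col_mx_geu m n (v : 'cV[R]_m) (w : 'cV[R]_n) :
  norm2 v <= norm2 (col_mx v w).
Proof.
by rewrite -ler_sqr ?nnegrE ?norm2_ge0 // sqr_norm2_col_mx lerDl sqr_ge0.
Qed.

Lemma norm2_col_mx_ged m n (v : 'cV[R]_m) (w : 'cV[R]_n) :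
  norm2 w <= norm2 (col_mx v w).
Proof.
by rewrite -ler_sqr ?nnegrE ?norm2_ge0 // sqr_norm2_col_mx lerDr sqr_ge0.
Qed.

(** Entries of [v] have modulus at most 1, so the sum of all [|A i j|] bounds the set. Boundedness
    is what makes [sup] an actual upper bound. *)
Lemma opnorm2_has_ubound m n (A : 'M[R]_(m, n)) :
  has_ubound [set norm2 (A *m v) | v in [set v : 'cV[R]_n | norm2 v <= 1]].
Proof.
exists (\sum_i \sum_j `|A i j|) => _ [v /= v1 <-].
apply: le_trans (norm2_le_sum _) _; apply: ler_sum => i _; rewrite mxE.
apply: le_trans (ler_norm_sum _ _ _) _; apply: ler_sum => j _.
by rewrite normrM ler_piMr // (le_trans (norm_coord_le_norm2 v j)).
Qed.

Lemma opnorm2_ge0 m n (A : 'M[R]_(m, n)) : 0 <= opnorm2 A.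
Proof.
apply: ub_le_sup; first exact: opnorm2_has_ubound.
by exists 0; rewrite /= ?mulmx0 norm2_0.
Qed.

Lemma norm2_mulmx m n (A : 'M[R]_(m, n)) (v : 'cV[R]_n) :
  norm2 (A *m v) <= opnorm2 A * norm2 v.
Proof.
(* A nonzero [v] is rescaled to a unit vector, where the supremum applies; the zero vector is set
   aside. *)
have [/norm2_eq0 ->|v0] := eqVneq (norm2 v) 0.
  by rewrite mulmx0 !norm2_0 mulr0.
have vp : 0 < norm2 v by rewrite lt_def v0 norm2_ge0.
have vE : v = norm2 v *: ((norm2 v)^-1 *: v) by rewrite scalerA divff // scale1r.
rewrite {1}vE -scalemxAr norm2Z ger0_norm ?norm2_ge0 // mulrC.
rewrite ler_wpM2r ?norm2_ge0 //; apply: ub_le_sup; first exact: opnorm2_has_ubound.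
exists ((norm2 v)^-1 *: v) => //=.
by rewrite norm2Z ger0_norm ?invr_ge0 ?norm2_ge0 // mulVf.
Qed.

Lemma norminf_ge0 n (v : 'cV[R]_n) : 0 <= norminf v.
Proof. exact: bigmax_ge_id. Qed.

Lemma norm_coord_le_norminf n (v : 'cV[R]_n) i : `|v i 0| <= norminf v.
Proof. exact: (le_bigmax _ (fun i => `|v i 0|)). Qed.

Lemma norminf_le n (v : 'cV[R]_n) (c : R) : 0 <= c ->
  (forall i, `|v i 0| <= c) -> norminf v <= c.
Proof. by move=> c0 vc; apply: bigmax_le. Qed.

Lemma opnorminf_has_ubound m n (A : 'M[R]_(m, n)) :
  has_ubound [set norminf (A *m v) | v in [set v : 'cV[R]_n | norminf v <= 1]].
Proof.
exists (\sum_i \sum_j `|A i j|) => _ [v /= v1 <-].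
apply: norminf_le => [|i]; first by apply: sumr_ge0 => i _; exact: sumr_ge0.
rewrite (bigD1 i) //= -[X in X <= _]addr0; apply: lerD; last first.
  by apply: sumr_ge0 => k _; exact: sumr_ge0.
rewrite mxE; apply: le_trans (ler_norm_sum _ _ _) _; apply: ler_sum => j _.
by rewrite normrM ler_piMr // (le_trans (norm_coord_le_norminf v j)).
Qed.

Lemma norm_mulmx_le_opnorminf m n (A : 'M[R]_(m, n)) (v : 'cV[R]_n) i :
  norminf v <= 1 -> `|(A *m v) i 0| <= opnorminf A.
Proof.
move=> v1; apply: le_trans (norm_coord_le_norminf _ _) _.
by apply: ub_le_sup; [exact: opnorminf_has_ubound | exists v].
Qed.

Lemma opnorminf_ge0 m n (A : 'M[R]_(m, n)) : 0 <= opnorminf A.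
Proof.
have n0 : norminf (0 : 'cV[R]_n) <= 1.
  by apply: norminf_le => // i; rewrite mxE normr0.
apply: le_trans (norminf_ge0 (A *m 0)) _.
by apply: ub_le_sup; [exact: opnorminf_has_ubound | exists 0].
Qed.

End Norms.

(** * Bounds, monotonicity and Lipschitz constants of the activation functions *)

Section Activations.
Variable R : realType.
Implicit Types s t : R.

Lemma coshR2_gt0 t : 0 < expR t + expR (- t).
Proof. by rewrite addr_gt0 ?expR_gt0. Qed.

Lemma is_derive_tanhR t : is_derive t 1 (@tanhR R) (1 - tanhR t ^+ 2).
Proof.
have c0 := coshR2_gt0 t.
have dN : is_derive t 1 (fun x : R => expR (- x)) (- expR (- t)).
  have := is_derive1_comp (is_derive_expR (- t)) (is_deriveNid t 1).
  by rewrite /= mulrN1.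
have dE := is_derive_expR t.
have cN0 : (expR + (fun x : R => expR (- x))) t != 0 by rewrite gt_eqF.
(* The quotient is differentiated as a product with an inverse; the derivative produced by the rules
   is simplified afterwards. *)
have dT : is_derive t 1 (@tanhR R) _ :=
  is_deriveM (is_deriveB dE dN) (is_deriveV cN0 (is_deriveD dE dN)).
apply: (is_derive_eq dT).
rewrite /GRing.scale /= /tanhR ?fctE.
by field; rewrite gt_eqF.
Qed.

Lemma norm_tanhR_lt1 t : `|tanhR t| < 1.
Proof.
have c0 := coshR2_gt0 t; have e0 := expR_gt0 t; have e1 := expR_gt0 (- t).
rewrite ltr_norml /tanhR ltr_pdivlMr // ltr_pdivrMr //.
by apply/andP; split; lra.
Qed.

(** Mean value theorem: the derivative [1 - tanhR c ^+ 2] lies between 0 and 1. This yields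
    monotonicity and the Lipschitz constant 1 together. *)
Lemma tanhR_incr s t : s <= t -> 0 <= tanhR t - tanhR s <= t - s.
Proof.
move=> st.
have [c _ ->] : exists2 c, c \in `[s, t] &
    tanhR t - tanhR s = (1 - tanhR c ^+ 2) * (t - s).
  apply: (MVT_segment st) => [x _|]; first exact: is_derive_tanhR.
  by apply: derivable_within_continuous => x _; have [] := is_derive_tanhR x.
have : tanhR c ^+ 2 <= 1.
  by rewrite -real_normK ?num_real // expr_le1 // ltW // norm_tanhR_lt1.
have := sqr_ge0 (tanhR c).
by nra.
Qed.

Lemma tanhR_lip s t : `|tanhR s - tanhR t| <= `|s - t|.
Proof.
wlog st : s t / t <= s.
  by move=> H; have [|/ltW] := leP t s => /H // ; rewrite distrC (distrC t).
have /andP[h0 h1] := tanhR_incr st.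
by rewrite !ger0_norm // subr_ge0.
Qed.

Lemma tanhRN t : tanhR (- t) = - tanhR t.
Proof. by rewrite /tanhR opprK -mulNr opprB (addrC (expR (- t)) (expR t)). Qed.

Lemma norm_tanhR_le t M : `|t| <= M -> `|tanhR t| <= tanhR M.
Proof.
rewrite !ler_norml => /andP[Mt tM]; apply/andP; split.
  by rewrite -tanhRN -subr_ge0; have /andP[] := tanhR_incr Mt.
by rewrite -subr_ge0; have /andP[] := tanhR_incr tM.
Qed.

Lemma tanhR_ge0 t : 0 <= t -> 0 <= tanhR t.
Proof.
move=> t0; apply: le_trans (normr_ge0 (tanhR t)) (norm_tanhR_le _).
by rewrite ger0_norm.
Qed.

(** Carries monotonicity and the Lipschitz bound over from [tanhR]: the factor 1/2 outside and the
    one inside make the constant 1/4. *)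
Lemma sigmoid_tanhR t : sigmoid t = 2^-1 + 2^-1 * tanhR (t / 2).
Proof.
have e0 := expR_gt0 (t / 2).
rewrite /sigmoid /tanhR; set h := t / 2.
have -> : - t = - h + - h by rewrite /h; field.
have -> : expR (- h + - h) = expR (- h) * expR (- h) by rewrite expRD.
rewrite expRN -/h; field.
by rewrite !gt_eqF // ?addr_gt0 ?mulr_gt0 ?ltr01.
Qed.

Lemma sigmoid_gt0 t : 0 < sigmoid t.
Proof. by rewrite divr_gt0 // addr_gt0 ?expR_gt0. Qed.

Lemma sigmoid_ge0 t : 0 <= sigmoid t.
Proof. exact/ltW/sigmoid_gt0. Qed.

Lemma sigmoid_lt1 t : sigmoid t < 1.
Proof. by rewrite ltr_pdivrMr ?addr_gt0 ?expR_gt0 // mul1r ltrDl expR_gt0. Qed.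

Lemma sigmoid_lip s t : `|sigmoid s - sigmoid t| <= 4^-1 * `|s - t|.
Proof.
have -> : sigmoid s - sigmoid t = 2^-1 * (tanhR (s / 2) - tanhR (t / 2)).
  by rewrite !sigmoid_tanhR; ring.
have -> : 4^-1 * `|s - t| = 2^-1 * `|s / 2 - t / 2|.
  by rewrite -mulrBl normrM [`|2^-1|]ger0_norm ?invr_ge0 //; field.
by rewrite normrM ger0_norm ?invr_ge0 // ler_wpM2l ?invr_ge0 // tanhR_lip.
Qed.

Lemma norm_sigmoid_le t M : `|t| <= M -> `|sigmoid t| <= sigmoid M.
Proof.
rewrite (ger0_norm (sigmoid_ge0 t)) => tM.
rewrite !sigmoid_tanhR lerD2l ler_pM2l ?invr_gt0 // -subr_ge0.
have /tanhR_incr/andP[]// : t / 2 <= M / 2.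
by rewrite ler_pM2r ?invr_gt0 // (le_trans (ler_norm t)).
Qed.

End Activations.

(** * Nonnegative 2x2 matrices of spectral radius below 1 *)

Section TwoByTwo.
Variable R : realType.

(** A real eigenvalue remains one over the complex numbers, with modulus [|r|]. *)
Lemma specrad_ge n (A : 'M[R]_n) (r : R) : eigenvalue A r -> r <= specrad A.
Proof.
move=> Ar; pose f := complex.real_complex R.
have rA : eigenvalue (map_mx f A) (f r) by rewrite eigenvalue_map.
apply: (@le_trans _ _ (Normc.normc (f r))).
  by rewrite /= expr0n addr0 sqrtr_sqr ler_norm.
apply: ub_le_sup; last by exists (f r).
(* The characteristic polynomial splits over the complex numbers, and the sum of the moduli of its
   roots bounds the set of eigenvalue moduli. *)
have [rs rsE] := closed_field_poly_normal (char_poly (map_mx f A)).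
exists (\sum_(z <- rs) Normc.normc z) => _ [l /= + <-].
rewrite eigenvalue_root_char rsE (monicP (char_poly_monic _)) scale1r.
rewrite root_prod_XsubC => lrs.
rewrite (big_rem l) //= lerDl; apply: sumr_ge0 => -[x y] _.
exact: sqrtr_ge0.
Qed.

Lemma char_poly_mat2 (a b c d r : R) :
  (char_poly (mat2 a b c d)).[r] = (r - a) * (r - d) - b * c.
Proof.
rewrite /char_poly (expand_det_row _ ord0) !big_ord_recl big_ord0 /cofactor.
rewrite !det_mx11 !mxE /= !hornerE /=; ring.
Qed.

(* The larger root of the characteristic polynomial, which is real since [b * c >= 0], is an eigenvalue. *)
Lemma specrad_mat2_lt1 (a b c d : R) :
  0 <= a -> 0 <= b -> 0 <= c -> 0 <= d -> specrad (mat2 a b c d) < 1 ->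
  [/\ a < 1, d < 1 & b * c < (1 - a) * (1 - d)].
Proof.
move=> a0 b0 c0 d0; pose D := (a - d) ^+ 2 + 4 * (b * c).
have bc0 : 0 <= b * c by rewrite mulr_ge0.
have D0 : 0 <= D by rewrite addr_ge0 ?sqr_ge0 // mulr_ge0.
have sD := sqr_sqrtr D0; have sD0 := sqrtr_ge0 D.
set s := Num.sqrt D in sD sD0; pose r := (a + d + s) / 2.
have rE : eigenvalue (mat2 a b c d) r.
  rewrite eigenvalue_root_char; apply/rootP; rewrite char_poly_mat2.
  have -> : (r - a) * (r - d) - b * c = (s ^+ 2 - D) / 4.
    by rewrite /r /D; field.
  by rewrite sD subrr mul0r.
move=> /(le_lt_trans (specrad_ge rE)) r1.
have {r1} s1 : s < 2 - a - d by rewrite /r in r1; lra.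
(* As [(2 - a - d)^2 - (a - d)^2 = 4 (1 - a) (1 - d)], squaring gives the determinant condition. *)
have : s ^+ 2 < (2 - a - d) ^+ 2 by rewrite ltr_sqr ?nnegrE //; lra.
rewrite sD /D => h.
have bcL : b * c < (1 - a) * (1 - d) by lra.
(* Both the product and the sum of [1 - a] and [1 - d] are positive. *)
suff : a < 1 /\ d < 1 by case.
by split; nra.
Qed.

(* The weights are the row vector [(1, 1) * (1 - A)^-1] scaled by [\det (1 - A)]. *)
Lemma specrad_mat2_weights (a b c d : R) :
  0 <= a -> 0 <= b -> 0 <= c -> 0 <= d -> specrad (mat2 a b c d) < 1 ->
  exists p q l : R, [/\ 0 < p, 0 < q, 0 < l < 1,
    p * a + q * c <= l * p & p * b + q * d <= l * q].
Proof.
move=> a0 b0 c0 d0 /specrad_mat2_lt1[]// a1 d1 bc.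
pose p := 1 - d + c; pose q := 1 - a + b.
have p0 : 0 < p by rewrite /p; lra.
have q0 : 0 < q by rewrite /q; lra.
(* Both ratios are below 1: [p - (p a + q c)] and [q - (p b + q d)] each equal
   [(1 - a) (1 - d) - b c]. The entry [2^-1] in the maximum below keeps the factor positive. *)
pose l1 := (p * a + q * c) / p; pose l2 := (p * b + q * d) / q.
exists p, q, (Num.max 2^-1 (Num.max l1 l2)); split => //.
- rewrite lt_max invr_gt0 ltr0n /= !gt_max; apply/and3P; split; first by lra.
    by rewrite ltr_pdivrMr // /p /q; lra.
  by rewrite ltr_pdivrMr // /p /q; lra.
- by rewrite -ler_pdivrMr // !le_max lexx orbT.
- by rewrite -ler_pdivrMr // !le_max lexx !orbT.
Qed.

End TwoByTwo.

(** * Gate arguments and entrywise products *)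

Section Networks.
Variables (R : realType) (nx nu : nat).
Implicit Types (W : 'M[R]_(nx, nu)) (U : 'M[R]_nx) (b x xi : 'cV[R]_nx).
Implicit Types (u : 'cV[R]_nu) (chi : 'cV[R]_nx * 'cV[R]_nx).

(** The gate argument is the concatenated matrix applied to the stacked vector of [u / umax], [xi]
    and 1, whose maximum norm is at most 1. *)
Lemma norm_gate_le (umax : R) W U b u xi i :
  in_inputset umax u -> (forall j, `|xi j 0| <= 1) ->
  `|(W *m u + U *m xi + b) i 0| <= gate_bound umax W U b.
Proof.
move=> uU xi1.
(* For [umax = 0] the input is [0], and so is [umax^-1]. *)
pose v := col_mx (col_mx (umax^-1 *: u) xi) (1%:M : 'M[R]_1).
have uE : umax *: (umax^-1 *: u) = u.
  have [u0|u0] := eqVneq umax 0; last by rewrite scalerA divff // scale1r.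
  apply/matrixP => j k; rewrite ord1 u0 scale0r mxE.
  by apply/esym/eqP; rewrite -normr_le0 -u0.
have -> : W *m u + U *m xi + b = row_mx (row_mx (umax *: W) U) b *m v.
  by rewrite !mul_row_col mulmx1 -scalemxAl scalemxAr uE.
apply: norm_mulmx_le_opnorminf; apply: norminf_le => // j.
rewrite /v mxE; case: splitP => k _; last first.
  by rewrite !ord1 mxE eqxx normr1.
rewrite mxE; case: splitP => h _; last exact: xi1.
rewrite mxE normrM normfV; have [->|u0] := eqVneq umax 0.
  by rewrite normr0 invr0 mul0r.
by rewrite mulrC ler_pdivrMr ?normr_gt0 // mul1r (le_trans (uU h)) ?ler_norm.
Qed.

Lemma norm2_gateB W U b u1 u2 x1 x2 :
  norm2 ((W *m u1 + U *m x1 + b) - (W *m u2 + U *m x2 + b))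
  <= opnorm2 W * norm2 (u1 - u2) + opnorm2 U * norm2 (x1 - x2).
Proof.
have -> : (W *m u1 + U *m x1 + b) - (W *m u2 + U *m x2 + b)
    = W *m (u1 - u2) + U *m (x1 - x2).
  by rewrite !mulmxBr opprD addrACA subrr addr0 opprD addrACA.
by apply: le_trans (norm2D _ _) _; apply: lerD; exact: norm2_mulmx.
Qed.

Lemma cmapE n (f : R -> R) (v : 'cV[R]_n) i : cmap f v i 0 = f (v i 0).
Proof. by rewrite mxE. Qed.

Lemma hadamardE n (v w : 'cV[R]_n) i : hadamard v w i 0 = v i 0 * w i 0.
Proof. by rewrite mxE. Qed.

Lemma norm2_cmapB n (f : R -> R) (L : R) (v w : 'cV[R]_n) : 0 <= L ->
  (forall s t, `|f s - f t| <= L * `|s - t|) ->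
  norm2 (cmap f v - cmap f w) <= L * norm2 (v - w).
Proof. by move=> L0 fL; apply: norm2_le => // i; rewrite !mxE. Qed.

(** Product rule: [a1 b1 - a2 b2 = a1 (b1 - b2) + (a1 - a2) b2]. *)
Lemma norm2_hadamardB n (a1 a2 b1 b2 : 'cV[R]_n) (A B : R) : 0 <= A -> 0 <= B ->
  (forall i, `|a1 i 0| <= A) -> (forall i, `|b2 i 0| <= B) ->
  norm2 (hadamard a1 b1 - hadamard a2 b2)
  <= A * norm2 (b1 - b2) + B * norm2 (a1 - a2).
Proof.
move=> A0 B0 aA bB.
have -> : hadamard a1 b1 - hadamard a2 b2
    = hadamard a1 (b1 - b2) + hadamard (a1 - a2) b2.
  by apply/matrixP => i j; rewrite !mxE; ring.
apply: le_trans (norm2D _ _) _; apply: lerD; apply: norm2_le => // i.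
- by rewrite mxE normrM ler_wpM2r.
- by rewrite mxE normrM mulrC ler_wpM2r.
Qed.

(** * Invariance of the state set and the one-step distance estimate *)

Section Step.
Variables (N : lstm R nx nu) (umax : R).

Lemma sgf_ge0 : 0 <= sgf N umax. Proof. exact: sigmoid_ge0. Qed.

Lemma sgi_ge0 : 0 <= sgi N umax. Proof. exact: sigmoid_ge0. Qed.

Lemma sgo_ge0 : 0 <= sgo N umax. Proof. exact: sigmoid_ge0. Qed.

Lemma sgf_lt1 : sgf N umax < 1. Proof. exact: sigmoid_lt1. Qed.

Lemma scc_ge0 : 0 <= scc N umax.
Proof. exact/tanhR_ge0/opnorminf_ge0. Qed.

Lemma xbound_ge0 : 0 <= xbound N umax.
Proof.
apply: divr_ge0; first exact: mulr_ge0 sgi_ge0 scc_ge0.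
by rewrite subr_ge0; exact/ltW/sgf_lt1.
Qed.

Lemma scx_ge0 : 0 <= scx N umax.
Proof. exact/tanhR_ge0/xbound_ge0. Qed.

(* [alpha_lstm] is the instance at the matrices [U]; the one at the matrices [W] is the gain from the input. *)
Definition cell_gain m (F C I : 'M[R]_(nx, m)) : R :=
  4^-1 * opnorm2 F * xbound N umax + sgi N umax * opnorm2 C
  + 4^-1 * opnorm2 I * scc N umax.

Lemma cell_gain_ge0 m (F C I : 'M[R]_(nx, m)) : 0 <= cell_gain F C I.
Proof.
rewrite /cell_gain; move: xbound_ge0 scc_ge0 sgi_ge0.
move: (xbound N umax) (scc N umax) (sgi N umax) => a b c a0 b0 c0.
by rewrite !addr_ge0 // !mulr_ge0 ?invr_ge0 ?opnorm2_ge0.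
Qed.

Lemma alpha_ge0 : 0 <= alpha_lstm N umax.
Proof. exact: cell_gain_ge0. Qed.

Lemma stateset_norm_xi chi : in_stateset N umax chi ->
  forall j, `|chi.2 j 0| <= 1.
Proof. by move=> cX j; case: (cX j) => _ /andP[? ?]; rewrite ler_norml !ltW. Qed.

(** The worst case of the cell update is [r -> sgf r + sgi scc], and [xbound] is its fixed point. A
    hidden entry is a gate value in (0, 1) times a value of [tanhR]. *)
Lemma stateset_step u chi : in_inputset umax u -> in_stateset N umax chi ->
  in_stateset N umax (lstm_step N u chi).
Proof.
case: chi => x xi uU cX; have xi1 := stateset_norm_xi cX.
move=> j; have [/= xj _] := cX j.
split=> /=; last first.
  rewrite hadamardE !cmapE.
  set t := tanhR _; set s := sigmoid _.
  rewrite -ltr_norml normrM; apply: (@le_lt_trans _ _ `|t|); last exact: norm_tanhR_lt1.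
  by rewrite ler_piMl // ger0_norm ?sigmoid_ge0 // ltW // sigmoid_lt1.
rewrite mxE !hadamardE !cmapE; apply: le_trans (ler_normD _ _) _.
have -> : xbound N umax
    = sgf N umax * xbound N umax + sgi N umax * scc N umax.
  have : 1 - sgf N umax != 0 by rewrite gt_eqF // subr_gt0 sgf_lt1.
  by rewrite /xbound => ?; field.
apply: lerD; rewrite normrM; apply: ler_pM => //; try exact/norm_sigmoid_le/norm_gate_le.
exact/norm_tanhR_le/norm_gate_le.
Qed.

Lemma stateset_traj (u : nat -> 'cV[R]_nu) chi k :
  (forall h, in_inputset umax (u h)) -> in_stateset N umax chi ->
  in_stateset N umax (lstm_traj N u chi k).
Proof. by move=> uU cX; elim: k => //= k IH; exact: stateset_step. Qed.

Definition input_gain_x : R := cell_gain (Wf N) (Wc N) (Wi N).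

(** The input reaches [xi] through the new cell state, damped by the output gate, and directly
    through the output gate. *)
Definition input_gain_xi : R :=
  sgo N umax * input_gain_x + 4^-1 * scx N umax * opnorm2 (Wo N).

Lemma input_gain_x_ge0 : 0 <= input_gain_x.
Proof. exact: cell_gain_ge0. Qed.

Lemma input_gain_xi_ge0 : 0 <= input_gain_xi.
Proof.
apply: addr_ge0; first exact: mulr_ge0 sgo_ge0 input_gain_x_ge0.
by apply: mulr_ge0 (opnorm2_ge0 _); apply: mulr_ge0 scx_ge0; rewrite invr_ge0.
Qed.

(** The update of [xi] reads the new cell state, so the second estimate contains the first one
    multiplied by [sgo]; the remaining terms come from the output gate. *)
Lemma lstm_step_dist u1 u2 chi1 chi2 :
  in_inputset umax u1 -> in_inputset umax u2 ->
  in_stateset N umax chi1 -> in_stateset N umax chi2 ->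
  let dx := norm2 (chi1.1 - chi2.1) in
  let dxi := norm2 (chi1.2 - chi2.2) in
  let du := norm2 (u1 - u2) in
  norm2 ((lstm_step N u1 chi1).1 - (lstm_step N u2 chi2).1)
    <= sgf N umax * dx + alpha_lstm N umax * dxi + input_gain_x * du /\
  norm2 ((lstm_step N u1 chi1).2 - (lstm_step N u2 chi2).2)
    <= sgo N umax * sgf N umax * dx
       + (alpha_lstm N umax * sgo N umax + 4^-1 * scx N umax * opnorm2 (Uo N)) * dxi
       + input_gain_xi * du.
Proof.
move=> uU1 uU2 cX1 cX2.
have xi1 := stateset_norm_xi cX1; have xi2 := stateset_norm_xi cX2.
(* Invariance bounds the updated cell state by [xbound], hence its [tanhR] by [scx]. *)
have sX2 := stateset_step uU2 cX2.
case: chi1 cX1 xi1 => x1 xi1 /= cX1 n1.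
case: chi2 cX2 xi2 sX2 => x2 xi2 /= cX2 n2 sX2.
have ge0_4 : 0 <= 4^-1 :> R by rewrite invr_ge0.
have lip4 n (v w : 'cV[R]_n) :
    norm2 (cmap (@sigmoid R) v - cmap (@sigmoid R) w) <= 4^-1 * norm2 (v - w).
  by apply: norm2_cmapB => //; exact: sigmoid_lip.
have lip1 n (v w : 'cV[R]_n) :
    norm2 (cmap (@tanhR R) v - cmap (@tanhR R) w) <= norm2 (v - w).
  rewrite -[X in _ <= X]mul1r; apply: norm2_cmapB => // s t.
  by rewrite mul1r tanhR_lip.
(* The product rule bounds left factors along the first trajectory and right factors along the
   second; hence sigmoid gates are bounded at [u1], [xi1] and [tanhR] values at [u2], [xi2]. *)
have sig W U b j : `|cmap (@sigmoid R) (W *m u1 + U *m xi1 + b) j 0|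
    <= sigmoid (gate_bound umax W U b).
  by rewrite cmapE; exact/norm_sigmoid_le/norm_gate_le.
have sigB W U b := le_trans (lip4 _ _ _)
  (ler_wpM2l ge0_4 (norm2_gateB W U b u1 u2 xi1 xi2)).
have := sigB (Wf N) (Uf N) (bf N); have := sig (Wf N) (Uf N) (bf N).
set f1 := cmap _ (Wf N *m u1 + _ + _); set f2 := cmap _ (Wf N *m u2 + _ + _).
rewrite -/(sgf N umax) => fL fB.
have := sigB (Wi N) (Ui N) (bi N); have := sig (Wi N) (Ui N) (bi N).
set i1 := cmap _ (Wi N *m u1 + _ + _); set i2 := cmap _ (Wi N *m u2 + _ + _).
rewrite -/(sgi N umax) => iL iB.
have := sigB (Wo N) (Uo N) (bo N); have := sig (Wo N) (Uo N) (bo N).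
set o1 := cmap _ (Wo N *m u1 + _ + _); set o2 := cmap _ (Wo N *m u2 + _ + _).
rewrite -/(sgo N umax) => oL oB.
have cL j : `|cmap (@tanhR R) (Wc N *m u2 + Uc N *m xi2 + bc N) j 0|
    <= scc N umax.
  by rewrite cmapE; exact/norm_tanhR_le/norm_gate_le.
have := le_trans (lip1 _ _ _)
  (norm2_gateB (Wc N) (Uc N) (bc N) u1 u2 xi1 xi2).
move: cL.
set c1 := cmap _ (Wc N *m u1 + _ + _); set c2 := cmap _ (Wc N *m u2 + _ + _).
move=> cL cB.
set xp1 := hadamard f1 x1 + hadamard i1 c1.
set xp2 := hadamard f2 x2 + hadamard i2 c2.
have xpB : norm2 (xp1 - xp2)
    <= sgf N umax * norm2 (x1 - x2) + xbound N umax * norm2 (f1 - f2)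
     + (sgi N umax * norm2 (c1 - c2) + scc N umax * norm2 (i1 - i2)).
  have -> : xp1 - xp2 = (hadamard f1 x1 - hadamard f2 x2)
                      + (hadamard i1 c1 - hadamard i2 c2).
    by rewrite /xp1 /xp2 opprD addrACA.
  apply: le_trans (norm2D _ _) _; apply: lerD; apply: norm2_hadamardB => //.
  - exact: sgf_ge0.
  - exact: xbound_ge0.
  - by move=> j; case: (cX2 j).
  - exact: sgi_ge0.
  - exact: scc_ge0.
have xipB : norm2 (hadamard o1 (cmap (@tanhR R) xp1)
                   - hadamard o2 (cmap (@tanhR R) xp2))
    <= sgo N umax * norm2 (xp1 - xp2) + scx N umax * norm2 (o1 - o2).
  apply: (@le_trans _ _ (sgo N umax * norm2 (cmap (@tanhR R) xp1 - cmap (@tanhR R) xp2)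
                         + scx N umax * norm2 (o1 - o2))).
    apply: norm2_hadamardB => //; [exact: sgo_ge0 | exact: scx_ge0 |].
    by move=> j; rewrite cmapE; apply: norm_tanhR_le; case: (sX2 j).
  by rewrite lerD2r; apply: ler_wpM2l (lip1 _ _ _); exact: sgo_ge0.
(* Only inequalities between reals remain, so all norms and bounds are abstracted into variables. *)
clearbody xp1 xp2; clearbody f1 f2 i1 i2 o1 o2 c1 c2.
move: xpB xipB fB iB oB cB sgf_ge0 sgi_ge0 sgo_ge0 scc_ge0 scx_ge0 xbound_ge0.
rewrite /input_gain_xi /input_gain_x /alpha_lstm /cell_gain.
move: (sgf N umax) (sgi N umax) (sgo N umax) (scc N umax) (scx N umax).
move: (xbound N umax) => X F I O C Y.
move: (norm2 (_ - hadamard _ _)) (norm2 (xp1 - xp2)) => dxi' dx'.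
move: (norm2 (f1 - f2)) (norm2 (i1 - i2)) (norm2 (o1 - o2)) (norm2 (c1 - c2)).
move=> df di dO dc.
move: (norm2 (x1 - x2)) (norm2 (xi1 - xi2)) (norm2 (u1 - u2)) => dx dxi du.
move: (opnorm2 (Uf N)) (opnorm2 (Ui N)) (opnorm2 (Uo N)) (opnorm2 (Uc N)).
move=> uf ui uo uc.
move: (opnorm2 (Wf N)) (opnorm2 (Wi N)) (opnorm2 (Wo N)) (opnorm2 (Wc N)).
move=> wf wi wo wc xpB xipB fB iB oB cB F0 I0 O0 C0 Y0 X0.
clear -xpB xipB fB iB oB cB F0 I0 O0 C0 Y0 X0.
(* Multiplying each gate estimate by its coefficient in advance leaves a problem linear in the
   monomials. *)
have kf := ler_wpM2l X0 fB; have ki := ler_wpM2l C0 iB.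
have kc := ler_wpM2l I0 cB; have ko := ler_wpM2l Y0 oB.
have {}xpB : dx' <= F * dx + (4^-1 * uf * X + I * uc + 4^-1 * ui * C) * dxi
    + (4^-1 * wf * X + I * wc + 4^-1 * wi * C) * du by lra.
by split=> //; have := ler_wpM2l O0 xpB; lra.
Qed.

End Step.

(** Inputs bounded by [umax] make the distances bounded uniformly in time, so the supremum dominates
    each of them. *)
Lemma le_input_dist (umax : R) (u1 u2 : nat -> 'cV[R]_nu) h :
  (forall k, in_inputset umax (u1 k)) -> (forall k, in_inputset umax (u2 k)) ->
  norm2 (u1 h - u2 h) <= input_dist u1 u2.
Proof.
move=> uU1 uU2; apply: ub_le_sup; last by exists h.
exists (\sum_(j < nu) (umax + umax)) => _ [k _ <-].
apply: le_trans (norm2_le_sum _) _; apply: ler_sum => j _; rewrite !mxE.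
by apply: le_trans (ler_normB _ _) _; apply: lerD; [exact: uU1|exact: uU2].
Qed.

End Networks.

(** * Linear and geometric comparison functions, and a scalar affine recursion *)

Section Comparison.
Variable R : realType.

Lemma classK_linear (c : R) : 0 < c -> classK (fun s => c * s).
Proof.
move=> c0; split; rewrite ?mulr0 //.
  by apply: continuous_subspaceT; exact: mulrl_continuous.
by move=> s t _ st; rewrite ltr_pM2l.
Qed.

Lemma classKinf_linear (c : R) : 0 < c -> classKinf (fun s => c * s).
Proof.
move=> c0; split; first exact: classK_linear.
by apply: gt0_cvgMry => //; exact: cvg_id.
Qed.

(** Positivity of [l] makes every function of [s] strictly increasing, and [l < 1] gives the decay
    in [k]. *)
Lemma classKL_geometric (c l : R) : 0 < c -> 0 < l < 1 ->
  classKL (fun s k => c * l ^+ k * s).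
Proof.
move=> c0 /andP[l0 l1]; split=> [k|s s0].
  by apply: classK_linear; rewrite mulr_gt0 ?exprn_gt0.
split=> [k m km|].
  by rewrite ler_wpM2r // ler_pM2l // ler_wiXn2l // ltW.
have -> : (fun k => c * l ^+ k * s) = geometric (c * s) l.
  by apply/funext => k; rewrite /geometric /= mulrAC.
by apply: cvg_geometric; rewrite ger0_norm // ltW.
Qed.

(** The constant [e / (1 - l)] is the fixed point of [v -> l v + e], which closes the induction. *)
Lemma affine_recursion_bound (V : nat -> R) (l e : R) : 0 < l < 1 -> 0 <= e ->
  (forall k, V k.+1 <= l * V k + e) ->
  forall k, V k <= l ^+ k * V 0%N + e / (1 - l).
Proof.
move=> /andP[l0 l1] e0 Vl; have l1' : 0 < 1 - l by rewrite subr_gt0.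
elim=> [|k IH]; first by rewrite expr0 mul1r lerDl divr_ge0 // ltW.
apply: le_trans (Vl k) _; rewrite exprS.
have := ler_wpM2l (ltW l0) IH.
have : e / (1 - l) = l * (e / (1 - l)) + e by field; rewrite gt_eqF.
by lra.
Qed.

End Comparison.

Theorem theorem2 (R : realType) (nx nu : nat) (N : lstm R nx nu) (umax : R) :
  specrad (A_delta N umax) < 1 ->
  exists (beta : R -> nat -> R) (gamma : R -> R),
    [/\ classKL beta, classKinf gamma &
      forall (k : nat) (chi01 chi02 : 'cV[R]_nx * 'cV[R]_nx)
             (u1 u2 : nat -> 'cV[R]_nu),
        in_stateset N umax chi01 -> in_stateset N umax chi02 ->
        (forall h, in_inputset umax (u1 h)) ->
        (forall h, in_inputset umax (u2 h)) ->
        state_dist (lstm_traj N u1 chi01 k) (lstm_traj N u2 chi02 k)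
        <= beta (state_dist chi01 chi02) k + gamma (input_dist u1 u2)].
Proof.
have f0 := sgf_ge0 N umax; have o0 := sgo_ge0 N umax.
have a0 := alpha_ge0 N umax; have c0 := mulr_ge0 o0 f0.
pose d := alpha_lstm N umax * sgo N umax + 4^-1 * scx N umax * opnorm2 (Uo N).
have d0 : 0 <= d.
  apply: addr_ge0; first exact: mulr_ge0.
  by apply: mulr_ge0 (opnorm2_ge0 _); apply: mulr_ge0 (scx_ge0 _ _); rewrite invr_ge0.
move=> /(specrad_mat2_weights f0 a0 c0 d0)[p [q [l [p0 q0 l01 h1 h2]]]].
(* The weighted distance lies between [m] and [p + q] times the Euclidean state distance; this gives
   the ratio [(p + q) / m] in [beta]. *)
pose m := Num.min p q; have m0 : 0 < m by rewrite lt_min p0.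
pose g := p * input_gain_x N umax + q * input_gain_xi N umax.
have gx0 := input_gain_x_ge0 N umax; have gxi0 := input_gain_xi_ge0 N umax.
have g0 : 0 <= g by rewrite addr_ge0 // mulr_ge0 // ltW.
have [_ l1] := andP l01; have l1' : 0 < 1 - l by rewrite subr_gt0.
exists (fun s k => (p + q) / m * l ^+ k * s).
(* The summand 1 keeps the slope positive even if [g] vanishes. *)
exists (fun s => (g / (1 - l) / m + 1) * s).
split; first by apply: classKL_geometric => //; rewrite divr_gt0 ?addr_gt0.
  by apply: classKinf_linear; rewrite ltr_wpDl // !divr_ge0 // ltW.
move=> k chi1 chi2 u1 u2 cX1 cX2 uU1 uU2.
pose z1 := lstm_traj N u1 chi1; pose z2 := lstm_traj N u2 chi2.
pose V k := p * norm2 ((z1 k).1 - (z2 k).1) + q * norm2 ((z1 k).2 - (z2 k).2).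
set D := input_dist u1 u2.
have D0 : 0 <= D := le_trans (norm2_ge0 _) (le_input_dist 0 uU1 uU2).
have VS j : V j.+1 <= l * V j + g * D.
  have [] := lstm_step_dist (uU1 j) (uU2 j) (stateset_traj j uU1 cX1)
    (stateset_traj j uU2 cX2).
  rewrite -/(z1 j) -/(z2 j) -/d.
  (* The two step estimates are added with weights [p] and [q]; the coefficients of the two
     distances are then the left-hand sides of [h1] and [h2]. *)
  move=> /(ler_wpM2l (ltW p0)) k1 /(ler_wpM2l (ltW q0)) k2.
  have k3 := ler_wpM2r (norm2_ge0 ((z1 j).1 - (z2 j).1)) h1.
  have k4 := ler_wpM2r (norm2_ge0 ((z1 j).2 - (z2 j).2)) h2.
  have k5 := ler_wpM2l g0 (le_input_dist j uU1 uU2).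
  rewrite -/D /g in k5; rewrite /V /= -/(z1 j) -/(z2 j) /g; lra.
have VB := affine_recursion_bound l01 (mulr_ge0 g0 D0) VS k.
have distE (x y : 'cV[R]_nx * 'cV[R]_nx) :
    state_dist x y = norm2 (col_mx (x.1 - y.1) (x.2 - y.2)).
  by rewrite /state_dist opp_col_mx add_col_mx.
have V0 : V 0%N <= (p + q) * state_dist chi1 chi2.
  rewrite distE mulrDl; apply: lerD; rewrite ler_pM2l //.
    exact: norm2_col_mx_geu.
  exact: norm2_col_mx_ged.
have Vk : m * state_dist (z1 k) (z2 k) <= V k.
  rewrite distE; apply: (@le_trans _ _
    (m * (norm2 ((z1 k).1 - (z2 k).1) + norm2 ((z1 k).2 - (z2 k).2)))).
    by rewrite ler_pM2l // norm2_col_mx_le.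
  by rewrite mulrDr; apply: lerD; rewrite ler_wpM2r ?norm2_ge0 // ge_min lexx ?orbT.
have lk0 : 0 <= l ^+ k by rewrite exprn_ge0 // ltW //; case/andP: l01.
(* The recursion bound, with [V 0] replaced by its upper estimate, is divided by [m]. *)
apply: (@le_trans _ _ ((l ^+ k * ((p + q) * state_dist chi1 chi2)
                        + g * D / (1 - l)) / m)).
  rewrite ler_pdivlMr // mulrC; apply: le_trans Vk (le_trans VB _).
  by rewrite lerD2r ler_wpM2l.
have -> : (l ^+ k * ((p + q) * state_dist chi1 chi2) + g * D / (1 - l)) / m
   = (p + q) / m * l ^+ k * state_dist chi1 chi2 + g / (1 - l) / m * D.
  by field; rewrite !gt_eqF.
by rewrite lerD2l ler_wpM2r // lerDl.
Qed.
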